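(* There exists a universal constant $K>0$ such that for all integers $d,n\ge1$: if $p$ is an $n$-variate flat block-multilinear polynomial of degree $d$ which $1/3$-approximates some Boolean function $f\colon\{-1,1\}^n\to\{-1,1\}$, then the sparsity of $p$ is at most $2^{Kd}$. (That is, no flat block-multilinear polynomial of degree $d$ and sparsity $2^{\omega(d)}$ can $1/3$-approximate a Boolean function.)
   Context: A multilinear real polynomial $p(x)=\sum_{S\subseteq[n]}\hat p(S)\prod_{i\in S}x_i$ is flat if all its non-zero coefficients have the same magnitude. Its sparsity is $|\{S:\hat p(S)\ne0\}|$. It is block-multilinear of degree $d$ if the variables $x_1,\dots,x_n$ can be partitioned into $d$ disjoint blocks $A_1,\dots,A_d$ such that every monomial of $p$ contains at most one variable from each block (so in particular $p$ has degree at most $d$). $p$ $1/3$-approximates $f$ if $|p(x)-f(x)|\le1/3$ for every $x\in\{-1,1\}^n$. *)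

(* Defs.v *)
From HB Require Import structures.
From mathcomp Require Import all_boot all_order all_algebra.
From mathcomp Require Import reals exp.

Set Implicit Arguments.
Unset Strict Implicit.
Unset Printing Implicit Defensive.

Import Order.TTheory GRing.Theory Num.Theory.
Local Open Scope ring_scope.

(* A multilinear polynomial in n variables is its family of coefficients:
   p S is the coefficient of the monomial \prod_(i in S) x_i. *)
Definition mlpoly (R : realType) (n : nat) := {ffun {set 'I_n} -> R}.

Section MultilinearPolynomials.
Variables (R : realType) (n : nat).
Implicit Types (p : mlpoly R n) (x : 'rV[R]_n).

Definition mleval p x : R :=
  \sum_(S : {set 'I_n}) p S * \prod_(i in S) x 0 i.

Definition mlsupp p : {set {set 'I_n}} := [set S | p S != 0].

Definition sparsity p : nat := #|mlsupp p|.

Definition flat p : Prop := {in mlsupp p &, forall S T, `|p S| = `|p T|}.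

(* The d blocks are disjoint and cover all variables; some may be empty, as is
   unavoidable when n < d. *)
Definition block_multilinear (d : nat) p : Prop :=
  exists A : 'I_d -> {set 'I_n},
    [/\ forall j k, j != k -> [disjoint A j & A k],
        \bigcup_j A j = [set: 'I_n]
      & {in mlsupp p, forall S j, (#|S :&: A j| <= 1)%N}].

Definition hypercube : pred 'rV[R]_n :=
  [pred x : 'rV[R]_n | [forall i, (x 0 i == -1) || (x 0 i == 1)]].

(* A function {-1,1}^n -> {-1,1}; the values of f off the hypercube are
   irrelevant. *)
Definition boolean_function (f : 'rV[R]_n -> R) : Prop :=
  {in hypercube, forall x, f x = -1 \/ f x = 1}.

Definition third_approximates p (f : 'rV[R]_n -> R) : Prop :=
  {in hypercube, forall x, `|mleval p x - f x| <= 1 / 3}.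

End MultilinearPolynomials.

(* Main.v *)
(** The function [f] inherits the degree bound of [p]: if [i] and [k] lie in the
    same block, the mixed second difference of [p] in directions [i], [k] is
    zero, while that of [f] is an even integer within [4/3] of it, hence zero
    too.  So the Fourier coefficients of [f] vanish above degree [d], are
    therefore integer multiples of [2^-d], and Parseval bounds their l1 norm by
    [2^d].  If [a] is the common magnitude of the coefficients of [p], then
    [2/3 <= E(f p) <= a 2^d], while [a^2 * sparsity p = E(p^2) <= 16/9]; hence
    the sparsity of [p] is at most [4^(d+1)]. *)

Require Import Defs.
From mathcomp Require Import all_boot all_order all_algebra.
From mathcomp Require Import reals exp.
From mathcomp Require Import ring lra.

Set Implicit Arguments.
Unset Strict Implicit.
Unset Printing Implicit Defensive.

Import Order.TTheory GRing.Theory Num.Theory.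
Local Open Scope ring_scope.

(** * Characters and expectations on the Boolean cube *)

Section FourierAnalysis.
Variables (R : realType) (I : finType).
Implicit Types (x : {ffun I -> bool}) (S T : {set I}).
Implicit Types (F : {ffun I -> bool} -> R) (i k : I).

Definition flip i x : {ffun I -> bool} := [ffun j => x j (+) (j == i)].

(* The bit [x i] encodes the sign [(-1) ^ x i]. *)
Definition chi S x : R := \prod_(i in S) (-1) ^+ x i.

Definition expect F : R := (2 ^+ #|I|)^-1 * \sum_x F x.

Definition fourier F S : R := expect (fun x => F x * chi S x).

Lemma flipK i : involutive (flip i).
Proof. by move=> x; apply/ffunP => j; rewrite !ffunE addbK. Qed.

Lemma chi_flip i S x : chi S (flip i x) = (-1) ^+ (i \in S) * chi S x.
Proof.
rewrite /chi; have [iS|iS] := boolP (i \in S).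
  rewrite [LHS](bigD1 i) //= [in RHS](bigD1 i) //= ffunE eqxx addbT mulrA; congr (_ * _).
    by case: (x i); rewrite /= expr1 expr0 ?mulrNN ?mulr1.
  by apply: eq_bigr => j /andP[_ /negbTE ji]; rewrite ffunE ji addbF.
rewrite expr0 mul1r; apply: eq_bigr => j jS; rewrite ffunE.
by case: eqP jS iS => [->->//|]; rewrite addbF.
Qed.

Lemma chi_sqr S x : chi S x * chi S x = 1.
Proof.
rewrite /chi -big_split big1 //= => i _.
by case: (x i); rewrite /= ?expr0 ?expr1 ?mulrNN mulr1.
Qed.

Lemma chi_int S x : chi S x \is a Num.int.
Proof. by apply: rpred_prod => i _; rewrite rpredX ?rpredN ?rpred1. Qed.

Lemma eq_expect F G : F =1 G -> expect F = expect G.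
Proof. by move=> FG; congr (_ * _); apply: eq_bigr => x _; exact: FG. Qed.

Lemma expect_flip i F : expect (fun x => F (flip i x)) = expect F.
Proof.
by congr (_ * _); rewrite [RHS](reindex_inj (inv_inj (flipK i))).
Qed.

Lemma expectD F G : expect (fun x => F x + G x) = expect F + expect G.
Proof. by rewrite /expect big_split mulrDr. Qed.

Lemma expectZ (c : R) F : expect (fun x => c * F x) = c * expect F.
Proof. by rewrite /expect -mulr_sumr mulrCA. Qed.

Lemma expect_sum (J : finType) (F : J -> {ffun I -> bool} -> R) :
  expect (fun x => \sum_j F j x) = \sum_j expect (F j).
Proof. by rewrite /expect exchange_big mulr_sumr. Qed.

Lemma expect_cst (c : R) : expect (fun=> c) = c.
Proof.
rewrite /expect sumr_const card_ffun card_bool -[c *+ _]mulr_natl natrX mulKf //.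
by rewrite expf_neq0 // pnatr_eq0.
Qed.

Lemma expect_le F G : (forall x, F x <= G x) -> expect F <= expect G.
Proof.
by move=> FG; rewrite ler_wpM2l ?ler_sum // invr_ge0 exprn_ge0 // ler0n.
Qed.

(** * Orthonormality, Plancherel and Bessel *)

Lemma chi_orthonormal S T : fourier (chi S) T = (S == T)%:R.
Proof.
have [->|nST] := eqVneq S T.
  by rewrite /fourier (eq_expect (chi_sqr T)) expect_cst.
(* Flipping a coordinate that lies in exactly one of the two sets negates the product of the
   characters, so its mean equals its own opposite. *)
have [i iST] : exists i, (i \in S) != (i \in T).
  apply/existsP; apply: contraNT nST => /existsPn ST.
  by apply/eqP/setP => i; apply/eqP; rewrite -[_ == _]negbK ST.
suff : fourier (chi S) T = - fourier (chi S) T by move=> /=; lra.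
rewrite -[in RHS](mulN1r) -expectZ -(expect_flip i); apply: eq_expect => x.
rewrite !chi_flip; case: (i \in S) (i \in T) iST => [] [] //= _;
by rewrite expr0 expr1; ring.
Qed.

Lemma fourier_poly (p : {set I} -> R) S :
  fourier (fun x => \sum_T p T * chi T x) S = p S.
Proof.
rewrite /fourier (eq_expect (G := fun x => \sum_T p T * (chi T x * chi S x))).
  rewrite expect_sum (bigD1 S) //= expectZ -/(fourier (chi S) S).
  rewrite chi_orthonormal eqxx mulr1 big1 ?addr0 // => T /negbTE TS.
  by rewrite expectZ -/(fourier (chi T) S) chi_orthonormal TS mulr0.
by move=> x; rewrite mulr_suml; apply: eq_bigr => T _; rewrite mulrA.
Qed.

Lemma plancherel_poly F (p : {set I} -> R) :
  expect (fun x => F x * \sum_S p S * chi S x) = \sum_S p S * fourier F S.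
Proof.
under [RHS]eq_bigr do rewrite -expectZ; rewrite -expect_sum.
apply: eq_expect => x; rewrite mulr_sumr; apply: eq_bigr => S _; ring.
Qed.

(** Positivity of E (F - G)^2, where [G] is the Fourier expansion of [F]: both E (F G) and E (G^2)
    equal the sum of squared coefficients. *)
Lemma bessel F : \sum_S fourier F S ^+ 2 <= expect (fun x => F x ^+ 2).
Proof.
pose G x := \sum_S fourier F S * chi S x.
have EFG : expect (fun x => F x * G x) = \sum_S fourier F S ^+ 2.
  by rewrite plancherel_poly; apply: eq_bigr => S _; rewrite expr2.
have EGG : expect (fun x => G x * G x) = \sum_S fourier F S ^+ 2.
  rewrite plancherel_poly; apply: eq_bigr => S _.
  by rewrite fourier_poly expr2.
have : 0 <= expect (fun x => (F x - G x) ^+ 2).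
  by rewrite -[0]expect_cst; apply: expect_le => x; exact: sqr_ge0.
rewrite (eq_expect (G := fun x => F x ^+ 2 + (- 2 * (F x * G x) + G x * G x))).
  by rewrite !expectD expectZ EFG EGG; lra.
by move=> x; ring.
Qed.

(** * Mixed second differences *)

Lemma fourier_flip i F S : i \in S ->
  fourier (fun x => F (flip i x)) S = - fourier F S.
Proof.
move=> iS; rewrite -[RHS]mulN1r -expectZ -[LHS](expect_flip i).
by apply: eq_expect => x; rewrite flipK chi_flip iS expr1; ring.
Qed.

Definition second_diff i k F x : R :=
  F x - F (flip i x) - F (flip k x) + F (flip i (flip k x)).

(** Each flip inside [S] negates the coefficient at [S], so [second_diff i k F] has coefficient 4 *
    [fourier F S] there. *)
Lemma fourier_eq0 i k F S : i \in S -> k \in S ->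
  (forall x, second_diff i k F x = 0) -> fourier F S = 0.
Proof.
move=> iS kS dF.
have : fourier (second_diff i k F) S = 0.
  by rewrite -[RHS]expect_cst; apply: eq_expect => x; rewrite dF mul0r.
rewrite /fourier (eq_expect (G := fun x => F x * chi S x +
    (-1 * (F (flip i x) * chi S x) + (-1 * (F (flip k x) * chi S x) +
    F (flip i (flip k x)) * chi S x)))); last first.
  by move=> x; rewrite /second_diff; ring.
rewrite !expectD !expectZ -!/(fourier _ S) !fourier_flip //.
rewrite -/(fourier (fun x => F (flip i (flip k x))) S).
rewrite (fourier_flip (fun x => F (flip i x)) kS) fourier_flip //; lra.
Qed.

(** A character that misses [i] or [k] is constant in that direction, so the mixed difference kills
    it. *)
Lemma second_diff_poly i k (p : {set I} -> R) x :
  (forall S, i \in S -> k \in S -> p S = 0) ->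
  second_diff i k (fun y => \sum_S p S * chi S y) x = 0.
Proof.
move=> p0; rewrite /second_diff -!sumrB -big_split big1 //= => S _.
rewrite !chi_flip; move: (p0 S).
case: (i \in S) (k \in S) => [] [] //= pS; rewrite ?expr0 ?expr1; last 3 first.
- by ring.
- by ring.
- by ring.
by rewrite pS //; ring.
Qed.

Lemma second_diff_sign i k F G x :
  (forall y, F y = -1 \/ F y = 1) -> (forall y, `|G y - F y| <= 1 / 3) ->
  second_diff i k G x = 0 -> second_diff i k F x = 0.
Proof.
move=> F1 GF; rewrite /second_diff.
have hF y : F y = -1 /\ - (4 / 3) <= G y <= - (2 / 3) \/
            F y = 1 /\ 2 / 3 <= G y <= 4 / 3.
  have := GF y; rewrite ler_distl => /andP[].
  by case: (F1 y) => -> ? ?; [left|right]; split => //; apply/andP; split; lra.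
(* Sixteen sign patterns: a nonzero alternating sum for [F] has size at least 2, which four errors
   of 1/3 cannot bring to zero for [G]. *)
case: (hF x) => -[-> /andP[? ?]]; case: (hF (flip i x)) => -[-> /andP[? ?]];
case: (hF (flip k x)) => -[-> /andP[? ?]];
case: (hF (flip i (flip k x))) => -[-> /andP[? ?]]; lra.
Qed.

(** * Integrality of Fourier coefficients *)

Lemma sum_chi_supset S x :
  \sum_(T : {set I} | S \subset T) chi T x =
  chi S x * (2 ^+ #|~: S| * \prod_(i in ~: S) (~~ x i)%:R).
Proof.
(* The sum over supersets factors over coordinates: each [i] in [S] contributes its sign, any other
   contributes 1 + (-1)^(x i), which is 2 or 0. *)
transitivity (\prod_i ((-1) ^+ x i + (i \notin S)%:R) : R).
  rewrite bigA_distr big_mkcond; apply: eq_bigr => T _.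
  case: ifPn => [ST|/subsetPn[i iS iT]].
    rewrite /chi big_mkcond; apply: eq_bigr => i _.
    by case: ifPn => // iT; rewrite (contra (subsetP ST i) iT).
  by rewrite (bigD1 i) //= (negbTE iT) iS mul0r.
rewrite (bigID (mem S)) /=; congr (_ * _).
  by apply: eq_bigr => i ->; rewrite addr0.
rewrite -prodr_const -big_split; apply: eq_big => [i|i iS]; first by rewrite inE.
by rewrite iS; case: (x i); rewrite /= ?expr0 ?expr1; ring.
Qed.

(** The superset sum of characters lives on the subcube where [x] is false off [S], with weight
    [2 ^+ #|~: S|]. Against the normalisation of [expect], this leaves a sum of the integers
    [F x * chi S x] over that subcube. *)
Lemma fourier_supset_int F S : (forall x, F x \is a Num.int) ->
  2 ^+ #|S| * (\sum_(T : {set I} | S \subset T) fourier F T) \is a Num.int.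
Proof.
move=> Fint; rewrite /fourier /expect -mulr_sumr exchange_big /=.
under eq_bigr do rewrite -mulr_sumr sum_chi_supset.
rewrite (eq_bigr (fun x => 2 ^+ #|~: S| *
  (F x * chi S x * \prod_(i in ~: S) (~~ x i)%:R))); last by move=> x _; ring.
rewrite -mulr_sumr 2!mulrA -(cardsC S) exprD.
rewrite [X in X * _](_ : _ = 1) ?mul1r; last first.
  by field; rewrite !expf_neq0 // pnatr_eq0.
apply: rpred_sum => x _; rewrite !rpredM ?chi_int //.
by apply: rpred_prod => i _; exact: rpred_nat.
Qed.

(** Downward induction from large sets: the coefficient at [S] is the superset sum minus the
    coefficients at proper supersets, and 2^d clears all their denominators. *)
Lemma fourier_int d F S : (forall x, F x \is a Num.int) ->
  (forall T, (d < #|T|)%N -> fourier F T = 0) ->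
  2 ^+ d * fourier F S \is a Num.int.
Proof.
move=> Fint F0; have [m] := ubnP (#|~: S|); elim: m S => // m IHm S ltm.
have [/F0->|leSd] := ltnP d #|S|; first by rewrite mulr0.
have := fourier_supset_int S Fint; rewrite (bigD1 S) //= => supint.
rewrite -[fourier F S](addrK
  (\sum_(T : {set I} | (S \subset T) && (T != S)) fourier F T)).
rewrite mulrBr rpredB //.
  by rewrite -(subnK leSd) exprD -mulrA rpredM // rpredX // rpred_nat.
rewrite mulr_sumr; apply: rpred_sum => T /andP[ST TS]; apply: IHm.
rewrite ltnS in ltm; apply: leq_trans ltm; apply: proper_card.
by rewrite properC properEneq eq_sym TS.
Qed.

(** * The l1 bound and the sparsity bound *)

Lemma fourier_l1 d F : (forall x, F x = -1 \/ F x = 1) ->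
  (forall T, (d < #|T|)%N -> fourier F T = 0) ->
  \sum_S `|fourier F S| <= 2 ^+ d.
Proof.
move=> F1 F0.
have Fint x : F x \is a Num.int by case: (F1 x) => ->; rewrite ?rpredN rpred1.
have d_gt0 : 0 < 2 ^+ d :> R by rewrite exprn_gt0 // ltr0n.
(* The integer t = 2^d * [fourier F S] satisfies |t| <= t^2; divide by 2^d. *)
have leS S : `|fourier F S| <= 2 ^+ d * fourier F S ^+ 2.
  rewrite -(ler_pM2l d_gt0) mulrA -expr2 -exprMn -[X in X * _]gtr0_norm //.
  rewrite -normrM -real_normK ?num_real //.
  have [->|nz] := eqVneq (2 ^+ d * fourier F S) 0; first by rewrite normr0 expr0n.
  by apply: ler_eXnr => //; exact: norm_intr_ge1 (fourier_int _ Fint F0) nz.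
apply: le_trans (ler_sum _ (fun S _ => leS S)) _.
rewrite -mulr_sumr -[leRHS]mulr1 ler_pM2l //; apply: le_trans (bessel F) _.
rewrite -[leRHS]expect_cst; apply: expect_le => x.
by case: (F1 x) => ->; rewrite ?sqrrN expr1n.
Qed.

Lemma flat_sparsity d (p : {set I} -> R) (a : R) F :
  (forall S, p S != 0 -> `|p S| = a) ->
  (forall x, F x = -1 \/ F x = 1) ->
  (forall x, `|\sum_S p S * chi S x - F x| <= 1 / 3) ->
  (forall T, (d < #|T|)%N -> fourier F T = 0) ->
  #|[set S | p S != 0]|%:R <= 4 ^+ d.+1 :> R.
Proof.
move=> pa F1 pF F0; set s := #|_|%:R.
(* On an empty support [a] is unconstrained and may be negative; otherwise it is the absolute value
   of a coefficient. *)
have [/eqP s0|] := boolP (#|[set S | p S != 0]| == 0%N).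
  by rewrite /s s0 mulr0n exprn_ge0.
rewrite -lt0n card_gt0 => /set0Pn[S0]; rewrite inE => /pa aE.
have a_ge0 : 0 <= a by rewrite -aE.
have s_ge0 : 0 <= s by rewrite ler0n.
(* [F] and the polynomial agree in sign and the latter has size at least 2/3, so their product is at
   least 2/3 everywhere. *)
have corr : 2 / 3 <= a * 2 ^+ d.
  rewrite -[leLHS]expect_cst.
  apply: (@le_trans _ _ (expect (fun x => F x * \sum_S p S * chi S x))).
    apply: expect_le => x; have := pF x; rewrite ler_distl => /andP[].
    by case: (F1 x) => -> ? ?; lra.
  rewrite plancherel_poly; apply: le_trans (ler_norm _) _.
  apply: le_trans (ler_norm_sum _ _ _) _.
  apply: (@le_trans _ _ (\sum_S a * `|fourier F S|)).
    apply: ler_sum => S _; rewrite normrM ler_wpM2r //.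
    by have [->|/pa->] := eqVneq (p S) 0; rewrite ?normr0.
  by rewrite -mulr_sumr ler_wpM2l // (fourier_l1 F1 F0).
(* Bessel for the polynomial itself, whose values have size at most 1 + 1/3. *)
have mass : a ^+ 2 * s <= 16 / 9.
  apply: (@le_trans _ _ (expect (fun x => (\sum_S p S * chi S x) ^+ 2))).
    apply: le_trans (bessel _); rewrite /s -sum1_card natr_sum mulr_sumr big_mkcond.
    apply: ler_sum => S _; rewrite fourier_poly inE.
    case: ifPn => [/pa<-|_]; last exact: sqr_ge0.
    by rewrite mulr1 real_normK ?num_real.
  rewrite -[leRHS]expect_cst; apply: expect_le => x.
  by have := pF x; rewrite ler_distl => /andP[]; case: (F1 x) => -> ? ?; nra.
(* Squaring [corr] and inserting [mass] gives (4/9) s <= (16/9) 4^d. *)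
have : (2 / 3) ^+ 2 * s <= (a * 2 ^+ d) ^+ 2 * s.
  by rewrite ler_wpM2r // lerXn2r // nnegrE; lra.
have -> : (a * 2 ^+ d) ^+ 2 * s = a ^+ 2 * s * 4 ^+ d.
  rewrite exprMn -exprM mulnC exprM.
  by rewrite (_ : 2 ^+ 2 = 4 :> R); ring.
have := ler_wpM2r (exprn_ge0 d (ler0n R 4)) mass.
by rewrite [4 ^+ d.+1]exprS; lra.
Qed.

End FourierAnalysis.

(** * Block structure and the final bound *)

Lemma card_block_le (n d : nat) (A : 'I_d -> {set 'I_n}) (S : {set 'I_n}) :
  \bigcup_j A j = [set: 'I_n] ->
  (forall j, (#|S :&: A j| <= 1)%N) -> (#|S| <= d)%N.
Proof.
move=> covA S1; have -> : S = \bigcup_j (S :&: A j).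
  by rewrite -big_distrr /= covA setIT.
apply: (@leq_trans (\sum_(j < d) #|S :&: A j|)%N); last first.
  by rewrite -[leqRHS]card_ord -sum1_card leq_sum.
elim/big_rec2: _ => [|j m B _ le]; first by rewrite cards0.
by rewrite (leq_trans (leq_card_setU _ _)) ?leq_add2l.
Qed.

Theorem theorem1p12 (R : realType) :
  exists K : R, 0 < K /\
    forall (d n : nat), (1 <= d)%N -> (1 <= n)%N ->
    forall p : mlpoly R n,
      flat p -> block_multilinear d p ->
      (exists f : 'rV[R]_n -> R, boolean_function f /\ third_approximates p f) ->
      (sparsity p)%:R <= 2 `^ (K * d%:R).
Proof.
(* The bound 4^(d+1) = 2^(2d+2) is at most 2^(4d) because d >= 1. *)
exists 4; split=> // d n d_gt0 _ p flatp [A [_ covA pA]] [f [fB pf]].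
pose vec (x : {ffun 'I_n -> bool}) : 'rV[R]_n := \row_i (-1) ^+ x i.
have vecP x : vec x \in @hypercube R n.
  rewrite inE; apply/forallP => i; rewrite mxE.
  by case: (x i); rewrite /= ?expr0 ?expr1 eqxx ?orbT.
pose F x := f (vec x).
have F1 x : F x = -1 \/ F x = 1 by exact: fB.
have evalE x : mleval p (vec x) = \sum_S p S * chi R S x.
  apply: eq_bigr => S _; congr (_ * _); apply: eq_bigr => i _.
  by rewrite mxE.
have pF x : `|\sum_S p S * chi R S x - F x| <= 1 / 3.
  by rewrite -evalE; exact: pf.
have F0 (T : {set 'I_n}) : (d < #|T|)%N -> fourier F T = 0.
  (* Pigeonhole: more than d variables put two in a common block. *)
  move=> dT; have [j] : exists j, (1 < #|T :&: A j|)%N.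
    apply/existsP; apply: contraLR dT => /existsPn T1.
    by rewrite -leqNgt (card_block_le covA) // => j; rewrite leqNgt.
  case/card_gt1P => i [k [/setIP[iT iA] /setIP[kT kA] ik]].
  apply: (fourier_eq0 iT kT) => x.
  (* No monomial of [p] contains both [i] and [k], as they share the block [A j]. *)
  apply: (second_diff_sign F1 pF); apply: second_diff_poly => S iS kS.
  apply/eqP/negPn/negP => pS.
  have := pA S; rewrite inE => /(_ pS j); rewrite leqNgt => /negP[].
  by apply/card_gt1P; exists i, k; rewrite !inE iS iA kS kA.
have le4 : (sparsity p)%:R <= 4 ^+ d.+1 :> R.
  have [/eqP->|] := boolP (sparsity p == 0%N); first by rewrite mulr0n exprn_ge0.
  rewrite -lt0n card_gt0 => /set0Pn[S0 S0p].
  apply: (flat_sparsity (a := `|p S0|)) F1 pF F0 => S pS.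
  by apply: flatp; rewrite // inE.
apply: le_trans le4 _.
rewrite -natrM powR_mulrn // (_ : 4 = 2 ^+ 2 :> R); last by ring.
rewrite -exprM ler_eXn2l ?ltr1n // (mulnDl 2 2) mulnS leq_add2r.
exact: leq_pmulr.
Qed.
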